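(* For $n\ge 1$ let $\beta_n$ be the number of pairs $(T,v)$ with $T$ a Motzkin tree on $n$ vertices and $v$ a balanced vertex of $T$, and let $\rho_n$ be the sum of the ranks of $v$ over all such pairs $(T,v)$. Then the asymptotic expected rank of a balanced vertex, $\lim_{n\to\infty}\frac{\rho_n}{\beta_n}$, satisfies $$0.6464847301966947\ \le\ \lim_{n\to\infty}\frac{\rho_n}{\beta_n}\ \le\ 0.64648473019669473 .$$
   Context: A Motzkin tree (0-1-2 tree, unary-binary tree) is a rooted plane tree, with at least one vertex, in which every vertex has 0, 1 or 2 children (a single child carries no left/right distinction; two children are ordered). A leaf is a vertex with no children. The rank of a vertex $v$ is the length (number of edges) of the shortest path from $v$ to a leaf travelling strictly from parent to child; leaves have rank 0. A vertex $v$ is balanced if all parent-to-child paths from $v$ to a leaf have the same length. The limit $\lim_{n\to\infty}\rho_n/\beta_n$ is known to exist. *)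

(* Defs.v *)
From Stdlib Require Import List Arith Lia.
Import ListNotations.

Inductive motzkin : Type :=
| Leaf
| Unary (t : motzkin)
| Binary (l r : motzkin).

Definition children (t : motzkin) : list motzkin :=
  match t with
  | Leaf => []
  | Unary t1 => [t1]
  | Binary l r => [l; r]
  end.

(* A vertex is addressed by the list of child indices (0 or 1) met on the way
   down to it from the root; [] is the root. *)
Fixpoint vertices (t : motzkin) : list (list nat) :=
  [] :: match t with
        | Leaf => []
        | Unary t1 => map (cons 0) (vertices t1)
        | Binary l r => map (cons 0) (vertices l) ++ map (cons 1) (vertices r)
        end.

Fixpoint subtree (t : motzkin) (v : list nat) : option motzkin :=
  match v with
  | [] => Some t
  | i :: v' =>
      match nth_error (children t) i with
      | Some s => subtree s v'
      | None => None
      end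
  end.

Definition is_leaf (t : motzkin) (v : list nat) : bool :=
  match subtree t v with
  | Some Leaf => true
  | _ => false
  end.

(* The lengths of all downward paths from v to a leaf: such a path is the
   address of a leaf in the subtree rooted at v. *)
Definition leaf_distances (t : motzkin) (v : list nat) : list nat :=
  match subtree t v with
  | Some s => map (@length nat) (filter (is_leaf s) (vertices s))
  | None => []
  end.

Definition list_min (ds : list nat) : nat :=
  match ds with
  | [] => 0
  | d :: ds' => fold_right Nat.min d ds'
  end.

Definition rank (t : motzkin) (v : list nat) : nat :=
  list_min (leaf_distances t v).

Definition balanced (t : motzkin) (v : list nat) : bool :=
  let ds := leaf_distances t v in
  forallb (fun d => forallb (Nat.eqb d) ds) ds.

(* All Motzkin trees of height at most h. *)
Fixpoint trees_height (h : nat) : list motzkin :=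
  match h with
  | 0 => [Leaf]
  | S h' =>
      let ts := trees_height h' in
      Leaf :: map Unary ts
        ++ map (fun p => Binary (fst p) (snd p)) (list_prod ts ts)
  end.

Definition num_vertices (t : motzkin) : nat := length (vertices t).

(* The height of a tree is less than its number of vertices, so no tree with n
   vertices is missed; see In_trees and NoDup_trees. *)
Definition trees (n : nat) : list motzkin :=
  filter (fun t => num_vertices t =? n) (trees_height n).

Definition balanced_pairs (n : nat) : list (motzkin * list nat) :=
  filter (fun p => balanced (fst p) (snd p))
    (flat_map (fun t => map (pair t) (vertices t)) (trees n)).

Definition beta (n : nat) : nat := length (balanced_pairs n).

Definition rho (n : nat) : nat :=
  list_sum (map (fun p => rank (fst p) (snd p)) (balanced_pairs n)).

Lemma In_vertices (t : motzkin) (v : list nat) :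
  In v (vertices t) <-> exists s, subtree t v = Some s.
Proof.
revert v; induction t as [|t1 IH|l IHl r IHr]; intros [|i v]; simpl;
  (split; [intros H | intros [s Hs]]); eauto.
- destruct H as [H|[]]; discriminate.
- destruct i; discriminate.
- destruct H as [H|H]; [discriminate|].
  apply in_map_iff in H as [w [E H]]; injection E as <- <-.
  now apply IH.
- right; destruct i as [|[|i]]; try discriminate.
  apply in_map, IH; eauto.
- destruct H as [H|H]; [discriminate|].
  apply in_app_or in H as [H|H]; apply in_map_iff in H as [w [E H]];
    injection E as <- <-; [now apply IHl | now apply IHr].
- right; apply in_or_app; destruct i as [|[|[|i]]]; try discriminate.
  + left; apply in_map, IHl; eauto.
  + right; apply in_map, IHr; eauto.
Qed.

Lemma NoDup_vertices (t : motzkin) : NoDup (vertices t).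
Proof.
assert (inj : forall i (a b : list nat), i :: a = i :: b -> a = b)
  by (intros i a b E; now injection E).
induction t as [|t1 IH|l IHl r IHr]; simpl; constructor; auto using NoDup_nil.
- rewrite in_map_iff; intros [w [E _]]; discriminate.
- apply NoDup_map_NoDup_ForallPairs; auto; intros a b _ _; apply inj.
- rewrite in_app_iff, !in_map_iff.
  intros [[w [E _]]|[w [E _]]]; discriminate.
- apply NoDup_app.
  + apply NoDup_map_NoDup_ForallPairs; auto; intros a b _ _; apply inj.
  + apply NoDup_map_NoDup_ForallPairs; auto; intros a b _ _; apply inj.
  + intros v; rewrite !in_map_iff; intros [w [<- _]] [w' [E _]]; discriminate.
Qed.

Lemma In_leaf_distances (t : motzkin) (v : list nat) (d : nat) :
  In d (leaf_distances t v) <->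
  exists p, length p = d /\ subtree t (v ++ p) = Some Leaf.
Proof.
assert (app : forall p,
  subtree t (v ++ p) = match subtree t v with
                       | Some s => subtree s p | None => None end).
{ intros p; revert t; induction v as [|i v IH]; intros t; simpl; auto.
  now destruct (nth_error (children t) i). }
unfold leaf_distances; setoid_rewrite app.
destruct (subtree t v) as [s|]; [|split; [easy|intros [p [_ H]]; easy]].
rewrite in_map_iff.
assert (leafP : forall p, is_leaf s p = true <-> subtree s p = Some Leaf).
{ intros p; unfold is_leaf; destruct (subtree s p) as [[| |]|]; easy. }
split; intros [p [Hd Hp]]; exists p; split; auto.
- apply filter_In in Hp as [_ Hp]; now apply leafP.
- apply filter_In; split; [apply In_vertices; eauto | now apply leafP].
Qed.

Lemma In_trees (n : nat) (t : motzkin) :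
  In t (trees n) <-> num_vertices t = n.
Proof.
assert (H : forall h, num_vertices t <= S h -> In t (trees_height h)).
{ unfold num_vertices.
  induction t as [|t1 IH|l IHl r IHr]; intros h.
  - destruct h; simpl; auto.
  - destruct h as [|h]; simpl; rewrite length_map.
    + destruct t1; simpl; lia.
    + intros Hh; right; apply in_or_app; left; apply in_map, IH; lia.
  - destruct h as [|h]; simpl; rewrite length_app, !length_map.
    + destruct l; simpl; lia.
    + intros Hh; right; apply in_or_app; right.
      apply in_map_iff; exists (l, r); split; [easy|].
      apply in_prod; [apply IHl | apply IHr]; lia. }
unfold trees; rewrite filter_In, Nat.eqb_eq; split; [easy|].
intros E; split; [apply H; lia | easy].
Qed.

Lemma NoDup_list_prod {A B : Type} (l : list A) (l' : list B) :
  NoDup l -> NoDup l' -> NoDup (list_prod l l').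
Proof.
intros Hl Hl'; induction Hl as [|a l Ha Hl IH]; simpl; [constructor|].
apply NoDup_app; auto.
- apply NoDup_map_NoDup_ForallPairs; auto.
  intros b c _ _ E; now injection E.
- intros [b c]; rewrite in_map_iff, in_prod_iff; intros [d [E _]] [Hb _].
  now injection E as -> ->.
Qed.

Lemma NoDup_trees (n : nat) : NoDup (trees n).
Proof.
apply NoDup_filter; generalize n; intros h; induction h as [|h IH]; simpl.
- constructor; [easy | constructor].
- constructor.
  + rewrite in_app_iff, !in_map_iff.
    intros [[w [E _]]|[w [E _]]]; discriminate.
  + apply NoDup_app.
    * apply NoDup_map_NoDup_ForallPairs; auto.
      intros a b _ _ E; now injection E.
    * apply NoDup_map_NoDup_ForallPairs; [|now apply NoDup_list_prod].
      intros [a b] [c d] _ _ E; simpl in E; injection E; congruence.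
    * intros t; rewrite !in_map_iff; intros [a [<- _]] [b [E _]]; discriminate.
Qed.

(* Main.v *)
(** For the series [X] in the number of vertices, let [M = X (1 + M + M^2)] count
    Motzkin trees and [P = 1 / (1 - X - 2 X M)] count trees with a marked leaf,
    the leaf itself not being counted: grafting a tree at the marked leaf shows
    that the pairs (tree, balanced vertex of rank [k]) are counted by [P * B k],
    where [B 0 = X] and [B (k+1) = X (B k + (B k)^2)] count the trees with all
    leaves at depth [k].

    Since [P^2 (1 - 2 X - 3 X^2) = 1], the coefficients of [P] satisfy a linear
    recurrence, by which consecutive ones have ratio tending to [3] and at least
    [2] (from the second on).  Hence the coefficient of [P * B k], divided by
    that of [P], tends to [b k = B k (1/3)] and stays below a constant times
    [B k (1/2)], which decays geometrically.  By Tannery's theorem the limit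
    is [(sum of k b k) / (sum of b k)], which is evaluated with integer interval
    arithmetic from [b 0 = 1/3], [b (k+1) = (b k + (b k)^2) / 3]. *)

Require Import Defs.
From Stdlib Require Import Reals ZArith List Lia Lra Permutation.
From Stdlib Require Import FunctionalExtensionality.
From Coquelicot Require Import Coquelicot.
(* Coquelicot's [AutoDerive] shadows the constructors [Unary] and [Binary]. *)
Import Defs.
Open Scope R_scope.

(** * Formal power series *)

Notation fps := (nat -> R).

Definition tl (a : fps) : fps := fun n => a (S n).
Definition cst (x : R) : fps := fun n => match n with O => x | S _ => 0 end.
Definition X : fps := fun n => match n with 1%nat => 1 | _ => 0 end.
Definition add (a b : fps) : fps := fun n => a n + b n.
Definition opp (a : fps) : fps := fun n => - a n.
Definition sub (a b : fps) : fps := add a (opp b).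

(* The Cauchy product, by recursion on the head of [a]: then its laws follow by
   induction on the index, without reindexing of sums. *)
Fixpoint conv (a b : fps) (n : nat) {struct n} : R :=
  match n with
  | O => a O * b O
  | S n' => a O * b n + conv (tl a) b n'
  end.

Definition der (a : fps) : fps := fun n => INR (S n) * a (S n).

Lemma conv_0_l (b : fps) (n : nat) : conv (fun _ => 0) b n = 0.
Proof.
  induction n as [|n IH]; simpl; [ring|].
  unfold tl; rewrite IH; ring.
Qed.

Lemma conv_cst_l (x : R) (b : fps) : conv (cst x) b = fun n => x * b n.
Proof.
  extensionality n; destruct n; simpl; [ring|].
  change (tl (cst x)) with (fun _ : nat => 0); rewrite conv_0_l; ring.
Qed.

Lemma conv_add_l (a b c : fps) : conv (add a b) c = add (conv a c) (conv b c).
Proof.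
  extensionality n; unfold add at 2; revert a b.
  induction n as [|n IH]; intros a b; simpl; [unfold add; ring|].
  change (tl (add a b)) with (add (tl a) (tl b)); rewrite IH; unfold add; ring.
Qed.

Lemma conv_scal_l (x : R) (a b : fps) (n : nat) :
  conv (fun k => x * a k) b n = x * conv a b n.
Proof.
  revert a; induction n as [|n IH]; intros a; simpl; [ring|].
  change (tl (fun k => x * a k)) with (fun k => x * tl a k); rewrite IH; ring.
Qed.

(** The definition of [conv] peels off the head of [a]; commutativity needs the mirror step, which
    peels off the head of [b]. *)
Lemma conv_S_r (a b : fps) (n : nat) :
  conv a b (S n) = conv a (tl b) n + a (S n) * b O.
Proof.
  revert a; induction n as [|n IH]; intros a; [simpl; unfold tl; ring|].
  change (conv a b (S (S n))) with (a O * b (S (S n)) + conv (tl a) b (S n)).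
  rewrite IH; simpl; unfold tl; ring.
Qed.

Lemma conv_comm (a b : fps) : conv a b = conv b a.
Proof.
  extensionality n; revert a b; induction n as [|n IH]; intros a b.
  - simpl; ring.
  - rewrite conv_S_r; simpl; rewrite (IH a (tl b)); ring.
Qed.

Lemma conv_assoc (a b c : fps) : conv a (conv b c) = conv (conv a b) c.
Proof.
  extensionality n; revert a b c; induction n as [|n IH]; intros a b c;
    [simpl; ring|].
  simpl.
  replace (tl (conv a b)) with (add (fun k => a O * tl b k) (conv (tl a) b))
    by (extensionality k; reflexivity).
  rewrite conv_add_l; unfold add; rewrite conv_scal_l, IH; ring.
Qed.

Lemma conv_der (a b : fps) :
  der (conv a b) = add (conv (der a) b) (conv a (der b)).
Proof.
  extensionality n; revert a b; induction n as [|n IH]; intros a b.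
  - unfold der, add; simpl; unfold tl; ring.
  (* Shift and derivative commute only up to a correction, because the factor [INR] sees the
     index. *)
  - assert (E : tl (der a) = add (der (tl a)) (tl (tl a)))
      by (extensionality k; unfold tl, der, add; rewrite (S_INR (S k)); ring).
    specialize (IH (tl a) b); unfold der at 1 in IH; unfold add in IH.
    unfold der at 1; unfold add.
    change (conv (der a) b (S n))
      with (der a O * b (S n) + conv (tl (der a)) b n).
    change (conv a (der b) (S n))
      with (a O * der b (S n) + conv (tl a) (der b) n).
    rewrite E, conv_add_l; unfold add.
    change (conv a b (S (S n))) with (a O * b (S (S n)) + conv (tl a) b (S n)).
    rewrite S_INR, Rmult_plus_distr_l.
    replace ((INR (S n) + 1) * conv (tl a) b (S n))
      with (INR (S n) * conv (tl a) b (S n) + conv (tl a) b (S n)) by ring.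
    rewrite IH.
    change (conv (tl a) b (S n))
      with (tl a O * b (S n) + conv (tl (tl a)) b n).
    unfold der, tl; simpl INR; ring.
Qed.

Lemma fps_ring_theory : ring_theory (cst 0) (cst 1) add conv sub opp (@eq fps).
Proof.
  constructor; intros.
  - extensionality n; unfold add; destruct n; simpl; ring.
  - extensionality n; unfold add; ring.
  - extensionality n; unfold add; ring.
  - rewrite conv_cst_l; extensionality n; ring.
  - apply conv_comm.
  - apply conv_assoc.
  - apply conv_add_l.
  - reflexivity.
  - extensionality n; unfold add, opp; destruct n; simpl; ring.
Qed.

Add Ring fps_ring_inst : fps_ring_theory.

Lemma conv_X (a : fps) (n : nat) : conv X a (S n) = a n.
Proof.
  simpl; replace (tl X) with (cst 1) by (extensionality k; now destruct k).
  rewrite conv_cst_l; ring.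
Qed.

Lemma conv_X_0 (a : fps) : conv X a O = 0.
Proof. simpl; ring. Qed.

Lemma conv_X_inj (a b : fps) : conv X a = conv X b -> a = b.
Proof.
  intros E; extensionality n; rewrite <- (conv_X a), <- (conv_X b).
  now rewrite E.
Qed.

(** * Sums over trees *)

Fixpoint lsum {A : Type} (f : A -> R) (l : list A) : R :=
  match l with
  | nil => 0
  | x :: l' => f x + lsum f l'
  end.

Lemma lsum_ext {A : Type} (f g : A -> R) (l : list A) :
  (forall x, In x l -> f x = g x) -> lsum f l = lsum g l.
Proof.
  induction l as [|x l IH]; simpl; intros H; [reflexivity|].
  rewrite H, IH; auto.
Qed.

Lemma lsum_app {A : Type} (f : A -> R) (l l' : list A) :
  lsum f (l ++ l') = lsum f l + lsum f l'.
Proof. induction l as [|x l IH]; simpl; [ring|]; rewrite IH; ring. Qed.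

Lemma lsum_map {A B : Type} (f : B -> R) (h : A -> B) (l : list A) :
  lsum f (map h l) = lsum (fun x => f (h x)) l.
Proof. induction l as [|x l IH]; simpl; [reflexivity|]; now rewrite IH. Qed.

Lemma lsum_flat_map {A B : Type} (f : B -> R) (h : A -> list B) (l : list A) :
  lsum f (flat_map h l) = lsum (fun x => lsum f (h x)) l.
Proof.
  induction l as [|x l IH]; simpl; [reflexivity|].
  now rewrite lsum_app, IH.
Qed.

Lemma lsum_add {A : Type} (f g : A -> R) (l : list A) :
  lsum (fun x => f x + g x) l = lsum f l + lsum g l.
Proof. induction l as [|x l IH]; simpl; [ring|]; rewrite IH; ring. Qed.

Lemma lsum_scal {A : Type} (x : R) (f : A -> R) (l : list A) :
  lsum (fun y => x * f y) l = x * lsum f l.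
Proof. induction l as [|y l IH]; simpl; [ring|]; rewrite IH; ring. Qed.

Lemma lsum_prod {A B : Type} (f : A -> R) (g : B -> R) (l : list A) (l' : list B) :
  lsum (fun p => f (fst p) * g (snd p)) (list_prod l l') = lsum f l * lsum g l'.
Proof.
  induction l as [|x l IH]; simpl; [ring|].
  rewrite lsum_app, lsum_map, IH; simpl; rewrite lsum_scal; ring.
Qed.

Lemma lsum_perm {A : Type} (f : A -> R) (l l' : list A) :
  Permutation l l' -> lsum f l = lsum f l'.
Proof. induction 1; simpl; try lra. Qed.

Lemma INR_list_sum_filter {A : Type} (f : A -> nat) (q : A -> bool) (l : list A) :
  INR (list_sum (map f (filter q l))) =
  lsum (fun x => if q x then INR (f x) else 0) l.
Proof.
  induction l as [|x l IH]; simpl; [reflexivity|].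
  destruct (q x); simpl; rewrite <- IH; [|ring].
  now rewrite <- plus_INR.
Qed.

Lemma conv_lsum (a b : fps) (n : nat) :
  conv a b n = lsum (fun i => a i * b (n - i)%nat) (seq 0 (S n)).
Proof.
  revert a; induction n as [|n IH]; intros a; [simpl; ring|].
  change (seq 0 (S (S n))) with (0%nat :: seq 1 (S n)).
  rewrite <- seq_shift; simpl conv; cbn [lsum]; rewrite lsum_map, IH.
  reflexivity.
Qed.

Definition tree_sum (F : motzkin -> R) : fps := fun n => lsum F (trees n).

Definition forests (n : nat) : list (motzkin * motzkin) :=
  flat_map (fun i => list_prod (trees i) (trees (n - i))) (seq 0 (S n)).

Lemma in_forests (n : nat) (p : motzkin * motzkin) :
  In p (forests n) <-> (num_vertices (fst p) + num_vertices (snd p) = n)%nat.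
Proof.
  destruct p as [l r]; unfold forests; rewrite in_flat_map; simpl fst; simpl snd.
  split.
  - intros [i [Hi Hp]]; apply in_prod_iff in Hp as [Hl Hr].
    apply In_trees in Hl; apply In_trees in Hr; apply in_seq in Hi; lia.
  - intros E; exists (num_vertices l); split; [apply in_seq; lia|].
    apply in_prod; apply In_trees; lia.
Qed.

Lemma NoDup_flat_map_disjoint {A B : Type} (f : A -> list B) (l : list A) :
  NoDup l -> (forall x, NoDup (f x)) ->
  (forall x y b, In b (f x) -> In b (f y) -> x = y) -> NoDup (flat_map f l).
Proof.
  intros Hl Hf Hd; induction Hl as [|x l Hx Hl IH]; simpl; [constructor|].
  apply NoDup_app; auto.
  intros b Hb Hb'; apply in_flat_map in Hb' as [y [Hy Hb']].
  now rewrite (Hd x y b Hb Hb') in Hx.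
Qed.

Lemma NoDup_forests (n : nat) : NoDup (forests n).
Proof.
  apply NoDup_flat_map_disjoint.
  - apply seq_NoDup.
  - intros i; apply NoDup_list_prod; apply NoDup_trees.
  - intros i j [l r] H H'; apply in_prod_iff in H as [H _].
    apply in_prod_iff in H' as [H' _].
    apply In_trees in H; apply In_trees in H'; congruence.
Qed.

Lemma num_vertices_Unary (t : motzkin) :
  num_vertices (Unary t) = S (num_vertices t).
Proof. unfold num_vertices; simpl; now rewrite length_map. Qed.

Lemma num_vertices_Binary (l r : motzkin) :
  num_vertices (Binary l r) = S (num_vertices l + num_vertices r).
Proof. unfold num_vertices; simpl; now rewrite length_app, !length_map. Qed.

Lemma num_vertices_pos (t : motzkin) : (0 < num_vertices t)%nat.
Proof. unfold num_vertices; destruct t; simpl; lia. Qed.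

(** [trees] filters an enumeration by height and so has no direct recursion on the size. Both sides
    are duplicate-free with the same members, and sums do not see the order. *)
Lemma trees_S (n : nat) :
  Permutation (trees (S n))
    ((if Nat.eqb n 0 then Leaf :: nil else nil) ++ map Unary (trees n)
       ++ map (fun p => Binary (fst p) (snd p)) (forests n)).
Proof.
  apply NoDup_Permutation; [apply NoDup_trees| |].
  - apply NoDup_app; [|apply NoDup_app|].
    + destruct (Nat.eqb n 0); repeat constructor; simpl; tauto.
    + apply NoDup_map_NoDup_ForallPairs; [|apply NoDup_trees].
      intros a b _ _ E; now injection E.
    + apply NoDup_map_NoDup_ForallPairs; [|apply NoDup_forests].
      intros [a b] [c d] _ _ E; simpl in E; injection E; congruence.
    + intros t; rewrite !in_map_iff; intros [a [<- _]] [b [E _]]; discriminate.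
    + intros t Ht; assert (t = Leaf) as ->
        by (destruct (Nat.eqb n 0); simpl in Ht; intuition).
      rewrite in_app_iff, !in_map_iff.
      intros [[w [E _]]|[w [E _]]]; discriminate.
  - intros t; rewrite In_trees, !in_app_iff, !in_map_iff.
    split.
    + destruct t as [|t|l r]; intros E.
      * left; unfold num_vertices in E; simpl in E; injection E as <-.
        simpl; auto.
      * right; left; exists t; split; [reflexivity|].
        apply In_trees; rewrite num_vertices_Unary in E; lia.
      * right; right; exists (l, r); split; [reflexivity|].
        apply in_forests; rewrite num_vertices_Binary in E; simpl; lia.
    + intros [H|[[t' [<- H]]|[[l r] [<- H]]]].
      * destruct n; simpl in H; [|tauto]; destruct H as [<-|[]]; reflexivity.
      * apply In_trees in H; rewrite num_vertices_Unary; lia.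
      * apply in_forests in H; simpl in *; rewrite num_vertices_Binary; lia.
Qed.

Lemma tree_sum_S (F : motzkin -> R) (n : nat) :
  tree_sum F (S n) =
  (if Nat.eqb n 0 then F Leaf else 0) + tree_sum (fun t => F (Unary t)) n +
  lsum (fun p => F (Binary (fst p) (snd p))) (forests n).
Proof.
  unfold tree_sum; rewrite (lsum_perm _ _ _ (trees_S n)), !lsum_app, !lsum_map.
  destruct (Nat.eqb n 0); simpl; ring.
Qed.

Lemma tree_sum_0 (F : motzkin -> R) : tree_sum F O = 0.
Proof. reflexivity. Qed.

Lemma lsum_forests (f g : motzkin -> R) (n : nat) :
  lsum (fun p => f (fst p) * g (snd p)) (forests n) =
  conv (tree_sum f) (tree_sum g) n.
Proof.
  unfold forests; rewrite lsum_flat_map, conv_lsum.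
  apply lsum_ext; intros i _; apply lsum_prod.
Qed.

Declare Scope fps_scope.
Delimit Scope fps_scope with fps.
Infix "+" := add : fps_scope.
Infix "-" := sub : fps_scope.
Infix "*" := conv : fps_scope.

Lemma fps_eq_X (a b : fps) :
  a O = 0 -> (forall n, a (S n) = b n) -> a = conv X b.
Proof.
  intros H0 HS; extensionality n; destruct n.
  - now rewrite H0, conv_X_0.
  - now rewrite conv_X.
Qed.

(** * Generating functions of trees and of marked vertices *)

Definition M : fps := tree_sum (fun _ => 1).

Lemma M_eq : M = (X * (cst 1 + M + M * M))%fps.
Proof.
  apply fps_eq_X; [reflexivity|]; intros n; unfold M at 1.
  rewrite tree_sum_S; unfold add.
  f_equal; [f_equal; now destruct n|].
  unfold M; rewrite <- lsum_forests; apply lsum_ext; intros; ring.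
Qed.

(** Balance and rank of a vertex depend only on its subtree, so both statistics have this form. *)
Definition vertex_sum (g : motzkin -> R) (t : motzkin) : R :=
  lsum (fun v => match subtree t v with Some s => g s | None => 0 end)
    (vertices t).

Lemma vertex_sum_Leaf (g : motzkin -> R) : vertex_sum g Leaf = g Leaf.
Proof. unfold vertex_sum; simpl; ring. Qed.

Lemma vertex_sum_Unary (g : motzkin -> R) (t : motzkin) :
  vertex_sum g (Unary t) = g (Unary t) + vertex_sum g t.
Proof. unfold vertex_sum; simpl; now rewrite lsum_map. Qed.

Lemma vertex_sum_Binary (g : motzkin -> R) (l r : motzkin) :
  vertex_sum g (Binary l r) = g (Binary l r) + (vertex_sum g l + vertex_sum g r).
Proof. unfold vertex_sum; simpl; now rewrite lsum_app, !lsum_map. Qed.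

(** The reciprocal of [P]: one step down towards a marked vertex costs [X] at a unary vertex and
    [X M] on either side of a binary one. *)
Definition D : fps := (cst 1 - X - X * (M + M))%fps.

(** The marked vertex is the root or lies in one child subtree, the other child being an arbitrary
    tree; solving this linear equation for [W] produces [D]. *)
Lemma tree_sum_vertex_sum (g : motzkin -> R) :
  (D * tree_sum (vertex_sum g))%fps = tree_sum g.
Proof.
  set (W := tree_sum (vertex_sum g)).
  assert (E : (W - tree_sum g = X * (W + (W * M + M * W)))%fps).
  { apply fps_eq_X; [unfold W, sub, add, opp; rewrite !tree_sum_0; ring|].
    intros n; unfold sub, add, opp, W, M.
    rewrite !tree_sum_S, <- !lsum_forests, <- lsum_add.
    rewrite (lsum_ext (fun p => vertex_sum g (Binary (fst p) (snd p)))
      (fun p => g (Binary (fst p) (snd p)) +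
        (vertex_sum g (fst p) * 1 + 1 * vertex_sum g (snd p)))).
    2: intros p _; rewrite vertex_sum_Binary; simpl; ring.
    rewrite lsum_add.
    replace (tree_sum (fun t => vertex_sum g (Unary t)) n)
      with (tree_sum (fun t => g (Unary t)) n + tree_sum (vertex_sum g) n).
    - rewrite vertex_sum_Leaf; ring.
    - unfold tree_sum; rewrite <- lsum_add; apply lsum_ext; intros t _.
      now rewrite vertex_sum_Unary. }
  transitivity (W - (W - tree_sum g))%fps; [|ring].
  rewrite E; unfold D; ring.
Qed.

(* Each tree is weighted by its number of leaves; the shift by [tl] leaves the
   marked leaf out of the vertex count. *)
Definition P : fps :=
  tl (tree_sum (vertex_sum (fun t => match t with Leaf => 1 | _ => 0 end))).

Lemma tree_sum_Leaf :
  tree_sum (fun t => match t with Leaf => 1 | _ => 0 end) = X.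
Proof.
  assert (H : forall (A : Type) (l : list A), lsum (fun _ => 0) l = 0)
    by (intros A l; induction l as [|x l IH]; simpl; [|rewrite IH]; ring).
  extensionality n; destruct n; [reflexivity|].
  rewrite tree_sum_S; unfold tree_sum; rewrite !H; destruct n; simpl; ring.
Qed.

Lemma D_P : (D * P)%fps = cst 1.
Proof.
  apply conv_X_inj.
  transitivity (D * (X * P))%fps; [ring|].
  transitivity X; [|ring].
  rewrite <- tree_sum_Leaf at 2; rewrite <- tree_sum_vertex_sum; f_equal.
  symmetry; now apply fps_eq_X.
Qed.

Lemma tree_sum_vertex_sum_P (g : motzkin -> R) :
  tree_sum (vertex_sum g) = (P * tree_sum g)%fps.
Proof.
  rewrite <- (tree_sum_vertex_sum g).
  transitivity ((D * P) * tree_sum (vertex_sum g))%fps; [rewrite D_P|]; ring.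
Qed.

(** [D] is a square root of the discriminant of the quadratic equation for [M]. The proof adds a
    multiple of that equation, which cancels [M]. *)
Lemma D_sq :
  (D * D)%fps = (cst 1 - (X + X) - (X + X + X) * X)%fps.
Proof.
  transitivity (cst 1 - (X + X) - (X + X + X) * X
    + (X + X + X + X) * (X * (cst 1 + M + M * M) - M))%fps;
    [unfold D; ring|].
  rewrite <- M_eq; ring.
Qed.

(** * Recurrence and growth of the coefficients of [P] *)

Lemma der_add (a b : fps) : der (a + b)%fps = (der a + der b)%fps.
Proof. extensionality n; unfold der, add; ring. Qed.

Lemma der_sub (a b : fps) : der (a - b)%fps = (der a - der b)%fps.
Proof. extensionality n; unfold der, sub, add, opp; ring. Qed.

Lemma der_cst (x : R) : der (cst x) = cst 0.
Proof. extensionality n; unfold der; destruct n; simpl; ring. Qed.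

Lemma der_X : der X = cst 1.
Proof. extensionality n; unfold der; destruct n as [|n]; simpl; ring. Qed.

(** An inverse square root of a polynomial satisfies a first-order linear equation: differentiate
    [D * P = 1], multiply by [2 D], and replace [D * D] and its derivative by polynomials. The
    doubling avoids a division by [2]. *)
Lemma P_ode :
  let a := (der P - (X + X) * der P - (X + X + X) * (X * der P))%fps in
  let b := (P + (X + X + X) * P)%fps in
  (a + a = b + b)%fps.
Proof.
  intros a b.
  assert (E1 : (der D * P + D * der P)%fps = cst 0)
    by (rewrite <- conv_der, D_P; apply der_cst).
  assert (E2 : (der D * D + D * der D)%fps
    = (cst 0 - (X + X + X + X + X + X) - (cst 1 + cst 1))%fps).
  { rewrite <- conv_der, D_sq, !der_sub, conv_der, !der_add, der_cst, der_X.
    ring. }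
  assert (E3 : ((D * D) * (der P + der P) + (der D * D + D * der D) * P)%fps
                = cst 0).
  { transitivity ((D + D) * (der D * P + D * der P))%fps; [ring|].
    rewrite E1; ring. }
  rewrite E2, D_sq in E3.
  transitivity (b + b + cst 0)%fps; [rewrite <- E3; unfold a, b; ring|ring].
Qed.

Lemma P_0 : P O = 1.
Proof.
  assert (E := equal_f D_P O); unfold D, sub, add, opp in E; simpl in E; lra.
Qed.

Lemma conv_3X (a : fps) (n : nat) : ((X + X + X) * a)%fps (S n) = 3 * a n.
Proof.
  rewrite !conv_add_l; unfold add; rewrite conv_X; ring.
Qed.

Lemma P_rec_coef (n : nat) :
  let a := (der P - (X + X) * der P - (X + X + X) * (X * der P))%fps in
  a (S n) = P (S n) + 3 * P n.
Proof.
  intros a; assert (E := equal_f P_ode (S n)); fold a in E; unfold add at 1 2 3 6 in E.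
  rewrite !conv_3X in E; lra.
Qed.

Lemma P_1 : P 1%nat = 1.
Proof.
  assert (E := equal_f P_ode O); unfold sub, opp, add, der in E; simpl in E.
  rewrite P_0 in E; lra.
Qed.

(** This is the recurrence of the central trinomial coefficients 1, 1, 3, 7, 19, ..., read off from
    the differential equation. *)
Lemma P_rec (n : nat) :
  (INR n + 2) * P (S (S n)) = (2 * INR n + 3) * P (S n) + 3 * (INR n + 1) * P n.
Proof.
  assert (E := P_rec_coef n); cbv zeta in E.
  unfold sub, opp in E; unfold add at 1 2 in E.
  rewrite conv_3X, conv_add_l in E; unfold add in E; rewrite conv_X in E.
  replace ((X * der P)%fps n) with (INR n * P n) in E.
  - unfold der in E; rewrite !S_INR in E; lra.
  - destruct n; [rewrite conv_X_0; simpl; ring|now rewrite conv_X].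
Qed.

(** The two ratio bounds feed each other: through the recurrence, the bound [5] at one step yields
    the bound [2] at the next, and conversely. *)
Lemma P_growth (n : nat) :
  0 < P n /\ 0 < P (S n) /\ 2 * P (S n) <= P (S (S n)) <= 5 * P (S n).
Proof.
  induction n as [|n [H0 [H1 [H2 H3]]]].
  - assert (E := P_rec 0); simpl INR in E; rewrite P_1, P_0 in *; lra.
  - assert (E := P_rec (S n)); rewrite S_INR in E.
    assert (Hn := pos_INR n).
    assert (0 <= INR n * P (S n)) by (apply Rmult_le_pos; lra).
    assert (0 <= INR n * P (S (S n))) by (apply Rmult_le_pos; lra).
    assert (INR n * (2 * P (S n)) <= INR n * P (S (S n)))
      by (apply Rmult_le_compat_l; lra).
    repeat split; try lra; apply Rmult_le_reg_l with (INR n + 3); lra.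
Qed.

Lemma P_pos (n : nat) : 0 < P n.
Proof. apply P_growth. Qed.

(* The recurrence reads [d (n+1) = - d n - (P (n+1) + 3 P n) / (n+2)] for
   [d n = P (n+1) - 3 P n], and [P] at least doubles at each step. *)
Lemma P_ratio_error (n : nat) :
  Rabs (P (S n) - 3 * P n) * (INR n + 1) <= 8 * P (S n).
Proof.
  destruct n as [|n]; [rewrite P_0, P_1; simpl; rewrite Rabs_left; lra|].
  induction n as [|n IH].
  - assert (E := P_rec 0); simpl INR in *; rewrite P_1, P_0 in *.
    rewrite Rabs_pos_eq; lra.
  - assert (E := P_rec (S n)); assert (G := P_growth n).
    rewrite !S_INR in *; assert (Hn := pos_INR n).
    set (d := P (S (S n)) - 3 * P (S n)) in *.
    set (d' := P (S (S (S n))) - 3 * P (S (S n))).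
    assert (E' : d' * (INR n + 1 + 2) =
      - (d * (INR n + 1 + 2)) - (P (S (S n)) + 3 * P (S n))).
    { unfold d', d; lra. }
    assert (G' := P_growth (S n)).
    assert (Hd : Rabs d' * (INR n + 1 + 2) <=
      Rabs d * (INR n + 1 + 2) + (P (S (S n)) + 3 * P (S n))).
    { rewrite <- (Rabs_pos_eq (INR n + 1 + 2)) at 1 by lra.
      rewrite <- Rabs_mult, E'.
      unfold Rminus; eapply Rle_trans; [apply Rabs_triang|].
      rewrite !Rabs_Ropp, Rabs_mult, !(Rabs_pos_eq (_ + _)) by lra; lra. }
    (* The constant [8] closes the induction: in units of [P (n+2)] the right side of [Hd] is at
       most [8 + 4 + 5/2], while doubling makes [8 P (n+3)] at least [16]. *)
    assert (0 <= Rabs d) by apply Rabs_pos.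
    assert (0 <= INR n * Rabs d) by (apply Rmult_le_pos; lra).
    replace (INR n + 1 + 1 + 1) with (INR n + 1 + 2) by ring.
    lra.
Qed.

Lemma P_ratio_lim : is_lim_seq (fun n => P n / P (S n)) (1 / 3).
Proof.
  (* The factor [3] rounds up the [8/3] that [P_ratio_error] gives after division by [3]. *)
  apply is_lim_seq_le_le with (fun n => 1 / 3 - 3 * / INR (S n))
    (fun n => 1 / 3 + 3 * / INR (S n)).
  - intros n; assert (H := P_ratio_error n); assert (Hp := P_pos (S n)).
    assert (Hn : 0 < INR (S n)) by (apply lt_0_INR; lia).
    rewrite <- S_INR in H.
    assert (K : Rabs (1 - 3 * (P n / P (S n))) <= 8 * / INR (S n)).
    { replace (1 - 3 * (P n / P (S n))) with ((P (S n) - 3 * P n) / P (S n))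
        by (field; lra).
      unfold Rdiv; rewrite Rabs_mult, (Rabs_pos_eq (/ P (S n)))
        by (left; now apply Rinv_0_lt_compat).
      apply Rmult_le_reg_r with (P (S n) * INR (S n));
        [now apply Rmult_lt_0_compat|].
      field_simplify; lra. }
    assert (0 < / INR (S n)) by now apply Rinv_0_lt_compat.
    apply Rabs_le_between in K; lra.
  - replace (Finite (1 / 3)) with (Rbar_minus (1 / 3) (Rbar_mult 3 0))
      by (simpl; f_equal; ring).
    apply is_lim_seq_minus'; [apply is_lim_seq_const|].
    apply (is_lim_seq_scal_l _ 3 0).
    apply (is_lim_seq_incr_1 (fun n => / INR n)).
    apply (is_lim_seq_inv _ p_infty); [apply is_lim_seq_INR | discriminate].
  - replace (Finite (1 / 3)) with (Rbar_plus (1 / 3) (Rbar_mult 3 0))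
      by (simpl; f_equal; ring).
    apply is_lim_seq_plus'; [apply is_lim_seq_const|].
    apply (is_lim_seq_scal_l _ 3 0).
    apply (is_lim_seq_incr_1 (fun n => / INR n)).
    apply (is_lim_seq_inv _ p_infty); [apply is_lim_seq_INR | discriminate].
Qed.

(** * Limits and uniform bounds for convolutions *)

(* [x] plays the role of the value of [a] at the singularity [1/3] of [P]. *)
Definition transfers (a : fps) (x : R) : Prop :=
  forall (u : fps) (l : R), is_lim_seq (fun n => u n / P n) l ->
    is_lim_seq (fun n => conv u a n / P n) (l * x).

Lemma transfers_X : transfers X (1 / 3).
Proof.
  intros u l H; apply is_lim_seq_incr_1.
  apply is_lim_seq_ext with (fun n => u n / P n * (P n / P (S n))).
  - intros n; rewrite conv_comm, conv_X.
    assert (H0 := P_pos n); assert (H1 := P_pos (S n)); field; lra.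
  - apply is_lim_seq_mult'; [exact H | exact P_ratio_lim].
Qed.

Lemma transfers_add (a b : fps) (x y : R) :
  transfers a x -> transfers b y -> transfers (a + b)%fps (x + y).
Proof.
  intros Ha Hb u l H; rewrite Rmult_plus_distr_l.
  apply is_lim_seq_ext with
    (fun n => conv u a n / P n + conv u b n / P n).
  - intros n; rewrite (conv_comm u (a + b)%fps), conv_add_l; unfold add.
    rewrite !(conv_comm u); unfold Rdiv; ring.
  - apply is_lim_seq_plus'; auto.
Qed.

(** Quantifying over every [u] pays off here: convolution with [a] gives another admissible
    sequence, to which the hypothesis on [b] applies. *)
Lemma transfers_conv (a b : fps) (x y : R) :
  transfers a x -> transfers b y -> transfers (a * b)%fps (x * y).
Proof.
  intros Ha Hb u l H; rewrite conv_assoc, <- Rmult_assoc; auto.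
Qed.

(* [P] with its constant coefficient lowered so that the sequence doubles from
   the start on. *)
Definition Q : fps := fun n => match n with O => 1 / 2 | S _ => P n end.

Lemma Q_double (n : nat) : 2 * Q n <= Q (S n).
Proof.
  destruct n; simpl; [rewrite P_1; lra|].
  assert (H := P_growth n); lra.
Qed.

Lemma Q_pos (n : nat) : 0 < Q n.
Proof. destruct n; simpl; [lra | apply P_pos]. Qed.

(** The counterpart of [transfers] that is uniform in [n]. Here [x] acts as the value of [a] at
    [1/2], since shifting [Q] by one index at least halves it. *)
Definition dominates (x : R) (a : fps) : Prop :=
  forall (u : fps) (c : R), (forall n, 0 <= u n <= c * Q n) ->
    forall n, 0 <= conv u a n <= c * x * Q n.

Lemma dominates_X : dominates (1 / 2) X.
Proof.
  intros u c H n; rewrite conv_comm.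
  assert (Hc : 0 <= c) by (specialize (H O); simpl in H; lra).
  destruct n; [rewrite conv_X_0; simpl; lra|].
  rewrite conv_X; specialize (H n); split; [apply H|].
  apply Rle_trans with (c * Q n); [apply H|].
  rewrite Rmult_assoc; apply Rmult_le_compat_l; [exact Hc|].
  assert (D := Q_double n); lra.
Qed.

Lemma dominates_add (a b : fps) (x y : R) :
  dominates x a -> dominates y b -> dominates (x + y) (a + b)%fps.
Proof.
  intros Ha Hb u c H n; specialize (Ha u c H n); specialize (Hb u c H n).
  rewrite (conv_comm u (a + b)%fps), conv_add_l; unfold add.
  rewrite <- !(conv_comm u); lra.
Qed.

Lemma dominates_conv (a b : fps) (x y : R) :
  dominates x a -> dominates y b -> dominates (x * y) (a * b)%fps.
Proof.
  intros Ha Hb u c H; rewrite conv_assoc, <- Rmult_assoc; auto.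
Qed.

(** * Balanced trees *)

(** Being balanced of rank [k] at the root, in a structural form from which the recursion for [B]
    follows. *)
Fixpoint level (t : motzkin) (k : nat) : bool :=
  match t, k with
  | Leaf, O => true
  | Unary t1, S k' => level t1 k'
  | Binary l r, S k' => (level l k' && level r k')%bool
  | _, _ => false
  end.

Definition indic (b : bool) : R := if b then 1 else 0.

Definition B (k : nat) : fps := tree_sum (fun t => indic (level t k)).

Lemma B_0 : B 0 = X.
Proof.
  rewrite <- tree_sum_Leaf; extensionality n.
  apply lsum_ext; intros [| |] _; reflexivity.
Qed.

Lemma B_S (k : nat) : B (S k) = (X * (B k + B k * B k))%fps.
Proof.
  apply fps_eq_X; [reflexivity|]; intros n; unfold B at 1.
  rewrite tree_sum_S; unfold add, B; rewrite <- lsum_forests.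
  simpl level; rewrite (lsum_ext _ (fun p =>
    indic (level (fst p) k) * indic (level (snd p) k))).
  - destruct (Nat.eqb n 0); simpl indic; ring.
  - intros [l r] _; simpl; destruct (level l k), (level r k); simpl; ring.
Qed.

(** The value at [x] of the polynomial [B k]. *)
Fixpoint bval (x : R) (k : nat) : R :=
  match k with
  | O => x
  | S k' => x * (bval x k' + bval x k' * bval x k')
  end.

Lemma transfers_B (k : nat) : transfers (B k) (bval (1 / 3) k).
Proof.
  induction k as [|k IH]; [rewrite B_0; apply transfers_X|].
  rewrite B_S; simpl; auto using transfers_X, transfers_add, transfers_conv.
Qed.

Lemma dominates_B (k : nat) : dominates (bval (1 / 2) k) (B k).
Proof.
  induction k as [|k IH]; [rewrite B_0; apply dominates_X|].
  rewrite B_S; simpl; auto using dominates_X, dominates_add, dominates_conv.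
Qed.

(** Values stay at most [1/2], so each step multiplies by at most [1/2 * (1 + 1/2) = 3/4]. *)
Lemma bval_half (k : nat) : 0 <= bval (1 / 2) k <= 1 / 2 * (3 / 4) ^ k.
Proof.
  induction k as [|k IH]; simpl; [lra|].
  assert (0 < (3 / 4) ^ k) by (apply pow_lt; lra).
  assert ((3 / 4) ^ k <= 1).
  { rewrite <- (pow1 k); apply pow_incr; lra. }
  split; [nra|].
  assert (bval (1 / 2) k * bval (1 / 2) k <= bval (1 / 2) k * (1 / 2))
    by (apply Rmult_le_compat_l; lra).
  lra.
Qed.

Lemma P_B_lim (k : nat) :
  is_lim_seq (fun n => conv P (B k) n / P n) (bval (1 / 3) k).
Proof.
  rewrite <- (Rmult_1_l (bval (1 / 3) k)); apply transfers_B.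
  apply is_lim_seq_ext with (fun _ => 1); [|apply is_lim_seq_const].
  intros n; assert (H := P_pos n); field; lra.
Qed.

Lemma P_B_bound (k n : nat) : 0 <= conv P (B k) n / P n <= (3 / 4) ^ k.
Proof.
  (* The factor [2] comes from [Q 0 = 1/2] and cancels against the [1/2] in [bval_half]. *)
  assert (HP : forall m, 0 <= P m <= 2 * Q m).
  { intros m; assert (H := P_pos m); destruct m; simpl; [rewrite P_0|]; lra. }
  destruct (dominates_B k P 2 HP n) as [H0 H1].
  assert (Hp := P_pos n); assert (Hb := bval_half k).
  assert (HQ : Q n <= P n) by (destruct n; simpl; [rewrite P_0|]; lra).
  split; [now apply Rdiv_le_0_compat|].
  apply Rle_div_l; [exact Hp|].
  apply Rle_trans with (2 * bval (1 / 2) k * Q n); [exact H1|].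
  assert (HQ0 := Q_pos n); apply Rmult_le_compat; lra.
Qed.

(** * Balance and rank expressed by [level] *)

Lemma subtree_leaf_exists (t : motzkin) : exists p, subtree t p = Some Leaf.
Proof.
  induction t as [|t [p H]|l [p H] r _];
    [exists nil | exists (0%nat :: p) | exists (0%nat :: p)]; auto.
Qed.

Lemma level_spec (t : motzkin) (k : nat) :
  level t k = true <->
  forall p, subtree t p = Some Leaf -> length p = k.
Proof.
  revert k; induction t as [|t IH|l IHl r IHr]; intros k.
  - split.
    + destruct k; [|discriminate]; intros _ [|[|i] p] H; simpl in H; try easy.
    + intros H; now rewrite <- (H nil eq_refl).
  - destruct (subtree_leaf_exists t) as [q Hq].
    destruct k as [|k]; simpl.
    + split; [discriminate|]; intros H.
      now specialize (H (0%nat :: q) Hq).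
    + rewrite IH; split.
      * intros H [|[|[|i]] p] Hp; simpl in *; try easy; now rewrite H.
      * intros H p Hp; specialize (H (0%nat :: p) Hp); now injection H.
  - destruct (subtree_leaf_exists l) as [q Hq].
    destruct k as [|k]; simpl.
    + split; [discriminate|]; intros H.
      now specialize (H (0%nat :: q) Hq).
    + rewrite Bool.andb_true_iff, IHl, IHr; split.
      * intros [Hl Hr] [|[|[|[|i]]] p] Hp; simpl in *; try easy;
          [now rewrite Hl | now rewrite Hr].
      * intros H; split; intros p Hp;
          [specialize (H (0%nat :: p) Hp) | specialize (H (1%nat :: p) Hp)];
          now injection H.
Qed.

Lemma level_lt (t : motzkin) (k : nat) :
  level t k = true -> (k < num_vertices t)%nat.
Proof.
  revert k; induction t as [|t IH|l IHl r IHr]; intros [|k] H; simpl in H;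
    try discriminate; try apply num_vertices_pos.
  - rewrite num_vertices_Unary; specialize (IH k H); lia.
  - apply andb_prop in H as [H _]; rewrite num_vertices_Binary.
    specialize (IHl k H); lia.
Qed.

Lemma list_min_const (ds : list nat) (k : nat) :
  ds <> nil -> (forall d, In d ds -> d = k) -> list_min ds = k.
Proof.
  destruct ds as [|d ds]; [easy|]; intros _ H; simpl.
  rewrite (H d) by (now left).
  assert (H' : forall e, In e ds -> e = k) by (intros e He; apply H; now right).
  clear H; induction ds as [|e ds IH]; simpl; [reflexivity|].
  rewrite IH, (H' e); [apply Nat.min_id | now left |].
  intros f Hf; apply H'; now right.
Qed.

(** The leaf distances form a nonempty list; it is constantly [k] exactly when its entries agree
    pairwise and its minimum is [k]. *)
Lemma level_balanced (t : motzkin) (k : nat) :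
  level t k = (balanced t nil && Nat.eqb (rank t nil) k)%bool.
Proof.
  unfold balanced, rank; set (ds := leaf_distances t nil).
  assert (Hds : forall d, In d ds <->
    exists p, length p = d /\ subtree t p = Some Leaf)
    by (intros d; apply (In_leaf_distances t nil)).
  assert (Hne : ds <> nil).
  { destruct (subtree_leaf_exists t) as [p Hp]; intros E.
    assert (H : In (length p) ds) by (apply Hds; eauto).
    now rewrite E in H. }
  assert (L : level t k = true <-> forall d, In d ds -> d = k).
  { rewrite level_spec; split.
    - intros H d Hd; apply Hds in Hd as [p [<- Hp]]; auto.
    - intros H p Hp; apply H, Hds; eauto. }
  apply Bool.eq_true_iff_eq; rewrite L, Bool.andb_true_iff, Nat.eqb_eq.
  rewrite forallb_forall; setoid_rewrite forallb_forall.
  setoid_rewrite Nat.eqb_eq; split.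
  - intros H; split; [|now apply list_min_const].
    intros x Hx y Hy; now rewrite (H x Hx), (H y Hy).
  - intros [H <-] d Hd; symmetry; apply list_min_const; [exact Hne|].
    intros e He; symmetry; now apply H.
Qed.

Lemma lsum_seq_S (f : nat -> R) (n : nat) :
  lsum f (seq 0 (S (S n))) = lsum f (seq 0 (S n)) + f (S n).
Proof. rewrite (seq_S (S n)), lsum_app; cbn [lsum]; rewrite Nat.add_0_l; ring. Qed.

Definition rank_weight (f : nat -> R) (t : motzkin) : R :=
  if balanced t nil then f (rank t nil) else 0.

(** Only the rank itself can contribute, and by [level_lt] it is below the number of vertices, so
    the cut at [N] loses nothing. *)
Lemma rank_weight_level (f : nat -> R) (t : motzkin) (N : nat) :
  (num_vertices t <= N)%nat ->
  rank_weight f t = lsum (fun k => f k * indic (level t k)) (seq 0 (S N)).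
Proof.
  intros HN; unfold rank_weight.
  assert (Z0 : forall l, lsum (fun k => f k * indic false) l = 0).
  { induction l as [|x l IH]; cbn [lsum]; [|rewrite IH; simpl]; ring. }
  rewrite (lsum_ext _
    (fun k => f k * indic (balanced t nil && Nat.eqb (rank t nil) k)))
    by (intros k _; now rewrite level_balanced).
  destruct (balanced t nil) eqn:Hb; simpl andb; [|now rewrite Z0].
  assert (Hr : (rank t nil <= N)%nat).
  { assert (H : level t (rank t nil) = true)
      by (rewrite level_balanced, Hb, Nat.eqb_refl; reflexivity).
    apply level_lt in H; lia. }
  set (r := rank t nil) in *; clearbody r.
  induction N as [|N IH] in Hr |- *.
  - replace r with O by lia; simpl; ring.
  - rewrite lsum_seq_S; destruct (Nat.eqb_spec r (S N)) as [->|Hne].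
    + rewrite (lsum_ext _ (fun k => f k * indic false)), Z0;
        [simpl; ring|].
      intros k Hk; apply in_seq in Hk; now destruct (Nat.eqb_spec (S N) k); [lia|].
    + rewrite <- (IH ltac:(lia)); simpl; ring.
Qed.

(** The expansion over ranks is cut at [n] and thus available only for coefficients up to [n], which
    are all that the product sees. *)
Lemma conv_ext_le (a b b' : fps) (n : nat) :
  (forall j, (j <= n)%nat -> b j = b' j) -> conv a b n = conv a b' n.
Proof.
  intros H; rewrite !conv_lsum; apply lsum_ext; intros i _.
  rewrite H; [reflexivity | lia].
Qed.

Lemma conv_lsum_r {A : Type} (a : fps) (f : A -> R) (b : A -> fps)
    (l : list A) (n : nat) :
  conv a (fun j => lsum (fun k => f k * b k j) l) n =
  lsum (fun k => f k * conv a (b k) n) l.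
Proof.
  rewrite conv_comm; induction l as [|x l IH]; simpl; [apply conv_0_l|].
  rewrite <- IH.
  change (fun j => f x * b x j + lsum (fun k => f k * b k j) l)
    with ((fun j => (f x * b x j)%R) +
          (fun j => lsum (fun k => f k * b k j)%R l))%fps.
  rewrite conv_add_l; unfold add; rewrite conv_scal_l, (conv_comm a); ring.
Qed.

Lemma lsum_exchange {A C : Type} (h : A -> C -> R) (l : list A) (l' : list C) :
  lsum (fun x => lsum (h x) l') l = lsum (fun y => lsum (fun x => h x y) l) l'.
Proof.
  induction l as [|x l IH]; simpl.
  - induction l' as [|y l' IH]; simpl; [|rewrite <- IH]; ring.
  - now rewrite IH, <- lsum_add.
Qed.

Lemma lsum_seq (f : nat -> R) (n : nat) : lsum f (seq 0 (S n)) = sum_n f n.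
Proof.
  induction n as [|n IH]; [rewrite sum_O; simpl; ring|].
  now rewrite lsum_seq_S, IH, sum_Sn.
Qed.

(** Serves both counts: constant [1] for [beta], the identity for [rho]. Grafting reduces marked
    vertices to roots, and the trees balanced at the root are then split by rank. *)
Lemma balanced_pairs_sum (f : nat -> nat) (n : nat) :
  INR (list_sum (map (fun p => f (rank (fst p) (snd p))) (balanced_pairs n))) =
  sum_n (fun k => INR (f k) * conv P (B k) n) n.
Proof.
  unfold balanced_pairs; rewrite INR_list_sum_filter, lsum_flat_map.
  transitivity (tree_sum (vertex_sum (rank_weight (fun k => INR (f k)))) n).
  - apply lsum_ext; intros t _; rewrite lsum_map; apply lsum_ext.
    intros v Hv; apply In_vertices in Hv as [s Hs]; rewrite Hs; simpl.
    unfold rank_weight, balanced, rank, leaf_distances; rewrite Hs; reflexivity.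
  - rewrite tree_sum_vertex_sum_P, <- lsum_seq, <- conv_lsum_r.
    apply conv_ext_le; intros j Hj; unfold B, tree_sum.
    rewrite (lsum_ext _ (fun t => lsum (fun k => INR (f k) * indic (level t k))
      (seq 0 (S n)))).
    + rewrite lsum_exchange; apply lsum_ext; intros k _; apply lsum_scal.
    + intros t Ht; apply In_trees in Ht; apply rank_weight_level; lia.
Qed.

(** * Exchange of limit and sum *)

Lemma sum_n_tail_le (a c : nat -> R) (K n : nat) :
  (forall k, Rabs (a k) <= c k) -> (K <= n)%nat ->
  Rabs (sum_n a n - sum_n a K) <= sum_n c n - sum_n c K.
Proof.
  intros H; induction 1 as [|n Hn IH].
  - rewrite !Rminus_diag, Rabs_R0; lra.
  - rewrite !sum_Sn; unfold plus; simpl.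
    replace (sum_n a n + a (S n) - sum_n a K)
      with (sum_n a n - sum_n a K + a (S n)) by ring.
    eapply Rle_trans; [apply Rabs_triang|]; specialize (H (S n)); lra.
Qed.

Lemma is_lim_seq_sum_n (a : nat -> nat -> R) (l : nat -> R) (K : nat) :
  (forall k, is_lim_seq (fun n => a n k) (l k)) ->
  is_lim_seq (fun n => sum_n (a n) K) (sum_n l K).
Proof.
  intros H; induction K as [|K IH].
  - rewrite sum_O; apply is_lim_seq_ext with (2 := H O).
    intros n; now rewrite sum_O.
  - rewrite sum_Sn.
    apply is_lim_seq_ext with (fun n => sum_n (a n) K + a n (S K));
      [intros n; now rewrite sum_Sn|].
    now apply is_lim_seq_plus'.
Qed.

Lemma tannery (a : nat -> nat -> R) (l c : nat -> R) :
  (forall k, is_lim_seq (fun n => a n k) (l k)) ->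
  (forall n k, Rabs (a n k) <= c k) -> ex_series c ->
  ex_series l /\ is_lim_seq (fun n => sum_n (a n) n) (Series l).
Proof.
  intros Hl Hc Hs.
  assert (Hlc : forall k, Rabs (l k) <= c k).
  { intros k; apply (is_lim_seq_le (fun n => Rabs (a n k)) (fun _ => c k)
      (Rabs (l k)) (c k)); [intros n; apply Hc | |apply is_lim_seq_const].
    apply (is_lim_seq_abs _ (l k)), Hl. }
  assert (Hex : ex_series l)
    by (apply (@ex_series_le R_AbsRing R_CompleteNormedModule l c);
        [exact Hlc | exact Hs]).
  split; [exact Hex|].
  assert (Sl := Series_correct _ Hex); assert (Sc := Series_correct _ Hs).
  change (is_lim_seq (sum_n l) (Series l)) in Sl.
  change (is_lim_seq (sum_n c) (Series c)) in Sc.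
  apply is_lim_seq_spec; apply is_lim_seq_spec in Sl, Sc; intros eps.
  (* One quarter goes to the tail of [l], one to the terms up to [K], and two to comparing the
     partial sums of [c] at [K] and [n] through their limit. *)
  assert (E4 : 0 < eps / 4) by (destruct eps; simpl; lra).
  destruct (Sl (mkposreal _ E4)) as [N1 H1].
  destruct (Sc (mkposreal _ E4)) as [N2 H2].
  set (K := Nat.max N1 N2).
  assert (Hk := is_lim_seq_sum_n a l K Hl); apply is_lim_seq_spec in Hk.
  destruct (Hk (mkposreal _ E4)) as [N3 H3]; simpl in H1, H2, H3.
  exists (Nat.max K N3); intros n Hn.
  specialize (H1 K ltac:(lia)); specialize (H3 n ltac:(lia)).
  assert (H2K := H2 K ltac:(lia)); assert (H2n := H2 n ltac:(lia)).
  assert (Ht := sum_n_tail_le (a n) c K n (Hc n) ltac:(lia)).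
  apply Rabs_lt_between in H1, H2K, H2n, H3; apply Rabs_le_between in Ht.
  apply Rabs_lt_between; destruct eps as [eps Heps]; simpl in *; lra.
Qed.

Definition b (k : nat) : R := bval (1 / 3) k.

Lemma balanced_pairs_lim (f : nat -> nat) :
  ex_series (fun k => INR (f k) * (3 / 4) ^ k) ->
  ex_series (fun k => INR (f k) * b k) /\
  is_lim_seq (fun n => INR (list_sum
      (map (fun p => f (rank (fst p) (snd p))) (balanced_pairs n))) / P n)
    (Series (fun k => INR (f k) * b k)).
Proof.
  intros Hs.
  destruct (tannery (fun n k => INR (f k) * (conv P (B k) n / P n))
    (fun k => INR (f k) * b k) (fun k => INR (f k) * (3 / 4) ^ k))
    as [H1 H2]; [| |exact Hs|split; [exact H1|]].
  - intros k; apply (is_lim_seq_scal_l _ (INR (f k)) (b k)), P_B_lim.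
  - intros n k; assert (H := P_B_bound k n); assert (Hf := pos_INR (f k)).
    rewrite Rabs_pos_eq; [apply Rmult_le_compat_l|apply Rmult_le_pos]; lra.
  - apply is_lim_seq_ext with (2 := H2); intros n.
    rewrite balanced_pairs_sum.
    etransitivity; [|apply (sum_n_mult_r (K := R_Ring) (/ P n))].
    apply sum_n_ext; intros k; unfold mult; simpl; unfold Rdiv; ring.
Qed.

(** Bernoulli's inequality gives [k <= 6 * (7/6)^k], and [7/6 * 3/4 = 7/8]. *)
Lemma ex_series_k_pow : ex_series (fun k => INR k * (3 / 4) ^ k).
Proof.
  apply (ex_series_le (V := R_CompleteNormedModule) _ (fun k => 6 * (7 / 8) ^ k)).
  - intros k; change (norm ?x) with (Rabs x).
    assert (Hk := pos_INR k); assert (H34 : 0 < (3 / 4) ^ k) by (apply pow_lt; lra).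
    rewrite Rabs_pos_eq by (apply Rmult_le_pos; lra).
    replace ((7 / 8) ^ k) with ((7 / 6) ^ k * (3 / 4) ^ k)
      by (rewrite <- Rpow_mult_distr; f_equal; field).
    rewrite <- Rmult_assoc; apply Rmult_le_compat_r; [lra|].
    assert (H := poly k (1 / 6) ltac:(lra)).
    replace (1 + 1 / 6) with (7 / 6) in H by field; lra.
  - apply (ex_series_scal_l (V := R_NormedModule) 6), ex_series_geom.
    rewrite Rabs_pos_eq; lra.
Qed.

Lemma beta_rho_lim :
  let S0 := Series b in let S1 := Series (fun k => INR k * b k) in
  ex_series b /\ ex_series (fun k => INR k * b k) /\
  is_lim_seq (fun n => INR (beta n) / P n) S0 /\
  is_lim_seq (fun n => INR (rho n) / P n) S1.
Proof.
  intros S0 S1.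
  assert (E1 : forall c : nat -> R, (fun k => INR 1 * c k) = c)
    by (intros c; extensionality k; simpl; ring).
  destruct (balanced_pairs_lim (fun _ => 1%nat)) as [H1 H2].
  { rewrite E1; apply ex_series_geom; rewrite Rabs_pos_eq; lra. }
  destruct (balanced_pairs_lim (fun k => k) ex_series_k_pow) as [H3 H4].
  rewrite E1 in H1, H2; repeat split; try assumption.
  apply is_lim_seq_ext with (2 := H2); intros n; do 2 f_equal; unfold beta.
  generalize (balanced_pairs n); intros l.
  induction l as [|x l IH]; simpl; [reflexivity | now rewrite IH].
Qed.

(** * Bounds on the mean from partial sums *)

Lemma b_S (k : nat) : b (S k) = 1 / 3 * (b k + b k * b k).
Proof. reflexivity. Qed.

Lemma b_bounds (k : nat) : 0 < b k <= 1 / 2.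
Proof.
  induction k as [|k IH]; [unfold b; simpl; lra|].
  rewrite b_S; split; nra.
Qed.

Lemma b_halves (k : nat) : 2 * b (S k) <= b k.
Proof. assert (H := b_bounds k); rewrite b_S; nra. Qed.

(** Comparing the mean rank with [c] becomes a question about the sign of the limit of these sums,
    free of division. *)
Definition excess (c : R) (n : nat) : R := sum_n (fun k => (INR k - c) * b k) n.

Lemma excess_S (c : R) (n : nat) :
  excess c (S n) = excess c n + (INR n + 1 - c) * b (S n).
Proof. unfold excess; now rewrite sum_Sn, S_INR. Qed.

Lemma excess_lim (c : R) :
  is_lim_seq (excess c) (Series (fun k => INR k * b k) - c * Series b).
Proof.
  destruct beta_rho_lim as [H0 [H1 _]].
  apply Series_correct in H0, H1.
  change (is_lim_seq (sum_n b) (Series b)) in H0.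
  change (is_lim_seq (sum_n (fun k => INR k * b k))
    (Series (fun k => INR k * b k))) in H1.
  apply is_lim_seq_ext with
    (fun n => sum_n (fun k => INR k * b k) n - c * sum_n b n).
  - intros n; induction n as [|n IH].
    + unfold excess; rewrite !sum_O; ring.
    + rewrite excess_S, <- IH, !sum_Sn, S_INR; unfold plus; simpl; ring.
  - apply is_lim_seq_minus'; [exact H1|].
    now apply (is_lim_seq_scal_l _ c (Series b)).
Qed.

(** For [c <= 1] every term after the first is nonnegative, so the partial sums increase. *)
Lemma excess_lower (c : R) (K : nat) :
  c <= 1 -> excess c K <= Series (fun k => INR k * b k) - c * Series b.
Proof.
  intros Hc.
  apply (is_lim_seq_le_loc (fun _ => excess c K) (excess c) (excess c K)
    (Series (fun k => INR k * b k) - c * Series b));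
    [|apply is_lim_seq_const|apply excess_lim].
  exists K; intros n; induction 1 as [|n Hn IH]; [lra|].
  rewrite excess_S; assert (H := b_bounds (S n)); assert (Hp := pos_INR n).
  assert (0 <= (INR n + 1 - c) * b (S n)) by (apply Rmult_le_pos; lra); lra.
Qed.

(* [excess c n + (n + 2) * b n] is decreasing in [n]. *)
Lemma excess_upper (c : R) (K : nat) :
  0 <= c ->
  Series (fun k => INR k * b k) - c * Series b <=
    excess c K + (INR K + 2) * b K.
Proof.
  intros Hc; set (x := excess c K + (INR K + 2) * b K).
  apply (is_lim_seq_le_loc (excess c) (fun _ => x)
    (Series (fun k => INR k * b k) - c * Series b) x);
    [|apply excess_lim|apply is_lim_seq_const].
  exists K; intros n Hn.
  assert (H : excess c n + (INR n + 2) * b n <= x).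
  { induction Hn as [|n Hn IH]; [unfold x; lra|].
    rewrite excess_S, S_INR; assert (H := b_halves n); assert (Hp := pos_INR n).
    assert (H' := b_bounds (S n)).
    assert ((INR n + 2) * (2 * b (S n)) <= (INR n + 2) * b n)
      by (apply Rmult_le_compat_l; lra).
    assert (0 <= c * b (S n)) by (apply Rmult_le_pos; lra); lra. }
  assert (Hp := pos_INR n); assert (H' := b_bounds n).
  assert (0 <= (INR n + 2) * b n) by (apply Rmult_le_pos; lra); lra.
Qed.

(** * Fixed-point evaluation *)

(** Integers around [s * b k]: the recursion for [b] scaled by [s], with floor division below and
    [+ 1] to round up above. *)
Fixpoint enclosure (s : Z) (k : nat) : Z * Z :=
  match k with
  | O => (s / 3, s / 3 + 1)%Z
  | S k' =>
      let (lo, hi) := enclosure s k' in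
      (lo * (s + lo) / (3 * s), hi * (s + hi) / (3 * s) + 1)%Z
  end.

Lemma IZR_div_bounds (x y : Z) :
  (0 < y)%Z -> IZR (x / y) * IZR y <= IZR x <= IZR (x / y + 1) * IZR y.
Proof.
  intros Hy; rewrite <- !mult_IZR; split; apply IZR_le.
  - rewrite Z.mul_comm; now apply Z.mul_div_le.
  - assert (H := Z.mul_succ_div_gt x y Hy); lia.
Qed.

Lemma enclosure_correct (s : Z) (k : nat) :
  (0 < s)%Z ->
  0 <= IZR (fst (enclosure s k)) <= IZR s * b k /\
  IZR s * b k <= IZR (snd (enclosure s k)).
Proof.
  intros Hs; assert (Hs' := IZR_lt _ _ Hs).
  induction k as [|k IH].
  - assert (H := IZR_div_bounds s 3 ltac:(lia)).
    assert (H0 : 0 <= IZR (s / 3)) by (apply IZR_le, Z.div_pos; lia).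
    cbn [enclosure fst snd]; change (b 0) with (1 / 3).
    repeat split; lra.
  - cbn [enclosure]; destruct (enclosure s k) as [lo hi].
    cbn [fst snd] in IH |- *.
    assert (Hlo : (0 <= lo)%Z) by (apply le_IZR; lra).
    assert (Hl := IZR_div_bounds (lo * (s + lo)) (3 * s) ltac:(lia)).
    assert (Hh := IZR_div_bounds (hi * (s + hi)) (3 * s) ltac:(lia)).
    rewrite !mult_IZR, !plus_IZR in Hl, Hh; rewrite !plus_IZR.
    assert (E : IZR s * b (S k) * (3 * IZR s) =
      IZR s * b k * (IZR s + IZR s * b k)) by (rewrite b_S; field).
    repeat split.
    + apply IZR_le, Z.div_pos; [apply Z.mul_nonneg_nonneg|]; lia.
    + apply Rmult_le_reg_r with (3 * IZR s); [lra|]; rewrite E.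
      eapply Rle_trans; [apply Hl|]; apply Rmult_le_compat; lra.
    + apply Rmult_le_reg_r with (3 * IZR s); [lra|]; rewrite E.
      eapply Rle_trans; [|apply Hh]; apply Rmult_le_compat; lra.
Qed.

(** Bounds [s * q * excess (p / q) n]. For [0 <= p <= q] only the weight at [k = 0] can be negative,
    hence the opposite end of the enclosure there. *)
Fixpoint excess_lo (s p q : Z) (n : nat) : Z :=
  match n with
  | O => - p * snd (enclosure s 0)
  | S n' => excess_lo s p q n' + (Z.of_nat n * q - p) * fst (enclosure s n)
  end%Z.

Fixpoint excess_hi (s p q : Z) (n : nat) : Z :=
  match n with
  | O => - p * fst (enclosure s 0)
  | S n' => excess_hi s p q n' + (Z.of_nat n * q - p) * snd (enclosure s n)
  end%Z.

Lemma excess_enclosure (s p q : Z) (n : nat) :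
  (0 < s)%Z -> (0 <= p <= q)%Z -> (0 < q)%Z ->
  IZR (excess_lo s p q n) <= IZR s * IZR q * excess (IZR p / IZR q) n <=
  IZR (excess_hi s p q n).
Proof.
  intros Hs Hp Hq; assert (Hq' := IZR_lt _ _ Hq).
  assert (H0 := IZR_le _ _ (proj1 Hp)); assert (H1 := IZR_le _ _ (proj2 Hp)).
  induction n as [|n IH].
  - assert (E := enclosure_correct s 0 Hs); unfold excess; rewrite sum_O.
    replace (IZR s * IZR q * ((INR 0 - IZR p / IZR q) * b 0))
      with (- IZR p * (IZR s * b 0)) by (simpl INR; field; lra).
    cbn [excess_lo excess_hi]; rewrite !mult_IZR, !opp_IZR.
    split; nra.
  - assert (E := enclosure_correct s (S n) Hs); rewrite excess_S.
    assert (Hn := pos_INR n).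
    replace (IZR s * IZR q *
      (excess (IZR p / IZR q) n + (INR n + 1 - IZR p / IZR q) * b (S n)))
      with (IZR s * IZR q * excess (IZR p / IZR q) n +
        ((INR n + 1) * IZR q - IZR p) * (IZR s * b (S n))) by (field; lra).
    cbn [excess_lo excess_hi].
    rewrite !plus_IZR, !mult_IZR, !minus_IZR, !mult_IZR, <- INR_IZR_INZ, S_INR.
    assert (0 <= INR n * IZR q) by (apply Rmult_le_pos; lra).
    split; apply Rplus_le_compat; try apply IH; apply Rmult_le_compat_l; lra.
Qed.

Lemma mean_rank_lower :
  0.6464847301966947 * Series b <= Series (fun k => INR k * b k).
Proof.
  (* The quotient [p / q] is the claimed bound. As [b k] shrinks about threefold per step, the
     remainder after rank [45] and the rounding at scale [s] are both far below [10^-17]. *)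
  pose (s := (10 ^ 25)%Z); pose (p := 6464847301966947%Z); pose (q := (10 ^ 16)%Z).
  assert (Hs : (0 < s)%Z) by reflexivity.
  assert (Hpq : (0 <= p <= q)%Z) by (split; apply Z.leb_le; reflexivity).
  assert (Hq : (0 < q)%Z) by reflexivity.
  assert (H := excess_enclosure s p q 45 Hs Hpq Hq).
  assert (C : 0 <= IZR (excess_lo s p q 45))
    by (apply IZR_le, Z.leb_le; vm_compute; reflexivity).
  assert (L := excess_lower (IZR p / IZR q) 45).
  replace (IZR p / IZR q) with 0.6464847301966947 in * by (unfold p, q; simpl; lra).
  assert (0 < IZR s * IZR q) by (apply Rmult_lt_0_compat; now apply IZR_lt).
  assert (0 <= excess 0.6464847301966947 45)
    by (apply Rmult_le_reg_l with (IZR s * IZR q); lra).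
  lra.
Qed.

Lemma mean_rank_upper :
  Series (fun k => INR k * b k) <= 0.64648473019669473 * Series b.
Proof.
  pose (s := (10 ^ 25)%Z); pose (p := 64648473019669473%Z); pose (q := (10 ^ 17)%Z).
  assert (Hs : (0 < s)%Z) by reflexivity.
  assert (Hpq : (0 <= p <= q)%Z) by (split; apply Z.leb_le; reflexivity).
  assert (Hq : (0 < q)%Z) by reflexivity.
  assert (H := excess_enclosure s p q 45 Hs Hpq Hq).
  assert (E := enclosure_correct s 45 Hs).
  (* Here [47] is [45 + 2], the factor of the tail bound in [excess_upper]. *)
  assert (C : IZR (excess_hi s p q 45 + 47 * q * snd (enclosure s 45)) <= 0)
    by (apply IZR_le, Z.leb_le; vm_compute; reflexivity).
  rewrite plus_IZR, !mult_IZR in C.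
  assert (U := excess_upper (IZR p / IZR q) 45).
  replace (IZR p / IZR q) with 0.64648473019669473 in * by (unfold p, q; simpl; lra).
  assert (Hq' : 0 < IZR q) by now apply IZR_lt.
  assert (0 < IZR s * IZR q) by (apply Rmult_lt_0_compat; [now apply IZR_lt | easy]).
  assert (47 * IZR q * (IZR s * b 45) <= 47 * IZR q * IZR (snd (enclosure s 45)))
    by (apply Rmult_le_compat_l; lra).
  rewrite INR_IZR_INZ in U; change (Z.of_nat 45) with 45%Z in U.
  assert (excess 0.64648473019669473 45 + (45 + 2) * b 45 <= 0)
    by (apply Rmult_le_reg_l with (IZR s * IZR q); lra).
  lra.
Qed.

Theorem theorem4p8 :
  exists L : R,
    is_lim_seq (fun n : nat => INR (rho n) / INR (beta n)) L /\
    0.6464847301966947 <= L <= 0.64648473019669473.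
Proof.
  destruct beta_rho_lim as [Hex [_ [Hb Hr]]].
  set (S0 := Series b) in *; set (S1 := Series (fun k => INR k * b k)) in *.
  assert (HS0 : 0 < S0).
  { apply Rlt_le_trans with (b 0); [apply b_bounds|].
    unfold S0; rewrite Series_incr_1 by exact Hex.
    assert (0 <= Series (fun k => b (S k))); [|lra].
    rewrite <- (Rmult_0_l (Series (fun _ => 0))), <- Series_scal_l.
    apply Series_le; [|now apply ex_series_incr_1 in Hex].
    intros k; assert (H := b_bounds (S k)); lra. }
  exists (S1 / S0); split.
  - apply is_lim_seq_ext with
      (fun n => (INR (rho n) / P n) / (INR (beta n) / P n)).
    + intros n; assert (H := P_pos n).
      (* [beta 0] is [0], since every tree has a vertex; in that case both quotients are [0] because
         [/ 0 = 0]. *)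
      destruct (Req_dec (INR (beta n)) 0) as [->|Hn];
        [|field; split; [exact Hn | lra]].
      unfold Rdiv; rewrite Rmult_0_l, Rinv_0; ring.
    + apply is_lim_seq_div'; [exact Hr | exact Hb | lra].
  - assert (Hlo := mean_rank_lower); assert (Hhi := mean_rank_upper).
    fold S0 S1 in Hlo, Hhi.
    split; [apply (Rle_div_r _ S1 S0) | apply (Rle_div_l S1 _ S0)]; lra.
Qed.
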